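(* Let $\mathsf{E}$ be a variety. Let $G$ be an object in $\mathsf{E}$ with subobject $H$ and inclusion $\iota:H\hookrightarrow G$. There exist categories $\mathsf{A}$ and $\mathsf{B}$, with $\mathsf{E}^{\leftrightarrow}\le\mathsf{A}\le\mathsf{E}$, such that the following are equivalent. (1) $H$ is characteristic in $G$. (2) There is a functor $\mathcal{C}:\mathsf{A}\to\mathsf{A}$ and a counit $\eta:\mathcal{C}\Rightarrow\mathrm{id}_{\mathsf{A}}$ such that $H=\mathrm{Im}(\eta_G)$. (3) There is an $(\mathsf{A},\mathsf{B})$-morphism $\mathcal{M}:\mathsf{B}\to\mathsf{A}$ (with respect to some $(\mathsf{A},\mathsf{B})$-bicapsule structures on $\mathsf{B}$ and on $\mathsf{A}$, where the left action of $\mathsf{A}$ on $\mathsf{A}$ and the right action of $\mathsf{B}$ on $\mathsf{B}$ are regular) such that $\iota=\mathcal{M}(\mathrm{id}_G\cdot\mathbb{1}_{\mathsf{B}})$.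
   Context: A variety $\mathsf{E}$ is the category of all algebras of a fixed (finitary, single-sorted) signature satisfying a fixed collection of equational laws, with all homomorphisms. $\mathsf{E}^{\leftrightarrow}$ is the subcategory of all objects and all isomorphisms; $\mathsf{X}\le\mathsf{Y}$ means $\mathsf{X}$ is a subcategory of $\mathsf{Y}$. A subalgebra $H$ of $G$ is characteristic if every automorphism $\varphi$ of $G$ restricts to an automorphism of $H$, i.e. $\varphi(H)=H$. A counit is a natural transformation $\mathcal{C}\Rightarrow\mathrm{id}_{\mathsf{A}}$. $\mathrm{Im}(\eta_G)$ is the image subalgebra of $G$. A category is identified with its collection of morphisms with partial composition $fg=f\circ g$. For a morphism $f$, let $s(f)$ and $t(f)$ be the identity morphisms of its domain and codomain; $fg$ is defined iff $s(f)=t(g)$. $\mathbb{1}_{\mathsf{A}}$ denotes the collection of identity morphisms of $\mathsf{A}$. A left action of a category $\mathsf{A}$ on a collection $X$ consists of a collection $\lhd X$, functions $a\mapsto a\lhd$ from $\mathsf{A}$ to $\lhd X$ and $x\mapsto\lhd x$ from $X$ to $\lhd X$, and a partial function $(a,x)\mapsto a\cdot x\in X$ such that: $a\cdot x$ is defined iff $a\lhd=\lhd x$; $s(a)\lhd=a\lhd$, and $s(a)\cdot x=x$ whenever defined; and if $(ab)\cdot x$ is defined then $a\cdot(b\cdot x)$ is defined and equal to it. The action is full if for every $a$ there is $x$ with $a\lhd=\lhd x$. A category $\mathsf{X}$ is a left $\mathsf{A}$-capsule if it has a full left $\mathsf{A}$-action (on morphisms) with $\lhd\mathsf{X}=\mathbb{1}_{\mathsf{X}}$,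 $\lhd x=t(x)$ and $a\cdot(xy)=(a\cdot x)y$. Right actions and right capsules are defined symmetrically. An $(\mathsf{A},\mathsf{B})$-bicapsule is a category $\mathsf{X}$ that is a left $\mathsf{A}$-capsule and a right $\mathsf{B}$-capsule with $a\cdot(x\cdot b)=(a\cdot x)\cdot b$. The left (right) regular action of a category on itself is by composition on the left (right). For a left $\mathsf{A}$-capsule $\mathsf{X}$ and a morphism $a$ of $\mathsf{A}$, there is exactly one $e\in\mathbb{1}_{\mathsf{X}}$ with $a\cdot e$ defined; $a\cdot\mathbb{1}_{\mathsf{X}}$ denotes the element $a\cdot e$. An $(\mathsf{A},\mathsf{B})$-morphism between $(\mathsf{A},\mathsf{B})$-bicapsules $\mathsf{Y}\to\mathsf{X}$ is a partial function $\mathcal{M}$ on morphisms such that, whenever $a\cdot y\cdot b$ is defined, $\mathcal{M}(a\cdot y\cdot b)$ is defined and equals $a\cdot\mathcal{M}(y)\cdot b$. It need not be a functor. *)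

(* Defs.v *)
From mathcomp Require Import all_boot.
From mathcomp Require Import boolp classical_sets.

Set Implicit Arguments.
Unset Strict Implicit.
Unset Printing Implicit Defensive.

(* A partial function X -> Y is a function X -> option Y; the coercion        *)
(* isSome reads an option as "is defined", and [obind] composes partial       *)
(* expressions, so that an equation between two [obind]s is a Kleene equality *)
(* (one side is defined iff the other is, and then they are equal).           *)

Local Open Scope classical_set_scope.

(* Arrows-only categories: src f and tgt f are the identity morphisms of the  *)
(* domain and codomain of f, and objects are identified with identities.      *)
Record category := Category {
  mor :> Type;
  src : mor -> mor;
  tgt : mor -> mor;
  comp : mor -> mor -> option mor;  (* comp f g is f \o g *)
  src_src : forall f, src (src f) = src f;
  tgt_src : forall f, tgt (src f) = src f;
  src_tgt : forall f, src (tgt f) = tgt f;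
  tgt_tgt : forall f, tgt (tgt f) = tgt f;
  comp_def : forall f g, comp f g <-> src f = tgt g;
  comp_st : forall f g h, comp f g = Some h -> src h = src g /\ tgt h = tgt f;
  comp_src : forall f, comp f (src f) = Some f;
  comp_tgt : forall f, comp (tgt f) f = Some f;
  comp_assoc : forall f g h,
    obind (comp f) (comp g h) = obind (fun k => comp k h) (comp f g) }.

Arguments src {c} f.
Arguments tgt {c} f.
Arguments comp {c} f g.

Definition ids (C : category) : Type := {e : C | src e = e}.

Definition src_id (C : category) (f : C) : ids C := exist _ (src f) (src_src f).
Definition tgt_id (C : category) (f : C) : ids C := exist _ (tgt f) (src_tgt f).

Lemma ids_inj (C : category) (e e' : ids C) : sval e = sval e' -> e = e'.
Proof. by case: e e' => [e He] [e' He'] /= E; apply: eq_exist. Qed.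

Lemma tgt_ids (C : category) (e : ids C) : tgt (sval e) = sval e.
Proof. by case: e => e /= He; rewrite -He tgt_src. Qed.

Definition iso (C : category) (f : C) : Prop :=
  exists g : C, comp f g = Some (tgt f) /\ comp g f = Some (src f).

Record subcategory (C : category) := Subcategory {
  sub_mor : set C;
  sub_src : forall f, sub_mor f -> sub_mor (src f);
  sub_tgt : forall f, sub_mor f -> sub_mor (tgt f);
  sub_comp : forall f g h,
    sub_mor f -> sub_mor g -> comp f g = Some h -> sub_mor h }.

Definition sub_le (C : category) (P Q : subcategory C) : Prop :=
  sub_mor P `<=` sub_mor Q.

Section SubCat.
Variables (C : category) (P : subcategory C).

Let subm : Type := {f : C | sub_mor P f}.

Definition subc_src (f : subm) : subm :=
  exist _ (src (sval f)) (sub_src (svalP f)).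
Definition subc_tgt (f : subm) : subm :=
  exist _ (tgt (sval f)) (sub_tgt (svalP f)).

Definition subc_lift (o : option C) :
    (forall h, o = Some h -> sub_mor P h) -> option subm :=
  match o with
  | Some h => fun k => Some (exist _ h (k h erefl))
  | None => fun=> None
  end.

Definition subc_comp (f g : subm) : option subm :=
  @subc_lift (comp (sval f) (sval g)) (fun h => sub_comp (svalP f) (svalP g)).

Lemma subm_inj (f g : subm) : sval f = sval g -> f = g.
Proof. by case: f g => [f Pf] [g Pg] /= E; apply: eq_exist. Qed.

Lemma subc_compE (f g : subm) :
  omap sval (subc_comp f g) = comp (sval f) (sval g).
Proof.
have liftE o (k : forall h, o = Some h -> sub_mor P h) :
  omap sval (subc_lift k) = o by case: o k.
exact: liftE.
Qed.

Lemma omap_sval_inj (o o' : option subm) : omap sval o = omap sval o' -> o = o'.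
Proof. by case: o o' => [x|] [y|] //= [] /subm_inj ->. Qed.

Lemma omap_obind (F : subm -> option subm) (F' : C -> option C) o :
  (forall x, omap sval (F x) = F' (sval x)) ->
  omap sval (obind F o) = obind F' (omap sval o).
Proof. by move=> FE; case: o => //= x; rewrite FE. Qed.

Definition subcat : category.
Proof.
refine (@Category subm subc_src subc_tgt subc_comp _ _ _ _ _ _ _ _ _).
- by move=> f; apply: subm_inj; rewrite /= src_src.
- by move=> f; apply: subm_inj; rewrite /= tgt_src.
- by move=> f; apply: subm_inj; rewrite /= src_tgt.
- by move=> f; apply: subm_inj; rewrite /= tgt_tgt.
- move=> f g.
  have -> : (subc_comp f g : bool) = comp (sval f) (sval g) :> bool.
    by rewrite -subc_compE; case: (subc_comp f g).
  rewrite comp_def; split=> [E|/(congr1 sval) //]; exact: subm_inj.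
- move=> f g h /(congr1 (omap sval)); rewrite subc_compE => /comp_st [Es Et].
  by split; apply: subm_inj.
- by move=> f; apply: omap_sval_inj; rewrite subc_compE /= comp_src.
- by move=> f; apply: omap_sval_inj; rewrite subc_compE /= comp_tgt.
- move=> f g h; apply: omap_sval_inj.
  rewrite (@omap_obind _ (comp (sval f))); last by move=> x; exact: subc_compE.
  rewrite (@omap_obind _ (fun k => comp k (sval h))).
    by rewrite !subc_compE comp_assoc.
  by move=> x; exact: subc_compE.
Defined.

End SubCat.

Coercion subcat : subcategory >-> category.

Lemma iso_src (C : category) (f : C) : iso (src f).
Proof.
exists (src f); rewrite tgt_src src_src.
by have := comp_src (src f); rewrite src_src.
Qed.

Lemma iso_tgt (C : category) (f : C) : iso (tgt f).
Proof. by rewrite -src_tgt; apply: iso_src. Qed.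

Lemma comp_mid (C : category) (f g g' f' h : C) :
  comp f g = Some h -> comp g g' = Some (tgt g) -> comp f f' = Some (tgt f) ->
  exists k, comp g' f' = Some k /\ comp h k = Some (tgt h).
Proof.
move=> Eh Eg Ef.
have [_ Eth] := comp_st Eh.
have dfg : src f = tgt g by apply/comp_def; rewrite Eh.
have dff' : src f = tgt f' by apply/comp_def; rewrite Ef.
have [sg' _] := comp_st Eg.
have /comp_def : src g' = tgt f' by rewrite -sg' src_tgt -dfg.
case Ek: (comp g' f') => [k|] // _; exists k; split=> //.
have := comp_assoc f g k; rewrite Eh /= => <-.
have := comp_assoc g g' f'; rewrite Ek Eg /= => ->.
by rewrite -dfg dff' comp_tgt /= Ef Eth.
Qed.

Definition core (C : category) : subcategory C.
Proof.
refine (@Subcategory C (@iso C) _ _ _).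
- by move=> f _; apply: iso_src.
- by move=> f _; apply: iso_tgt.
- move=> f g h [f' [ff' f'f]] [g' [gg' g'g]] Eh.
  have dfg : src f = tgt g by apply/comp_def; rewrite Eh.
  have [sh th] := comp_st Eh.
  have [k [Ek hk]] := comp_mid Eh gg' ff'.
  have tg' : tgt g' = src g by case: (comp_st g'g) => _ <-; rewrite tgt_src.
  have sg' : src g' = tgt g by case: (comp_st gg') => <- _; rewrite src_tgt.
  have tf' : tgt f' = src f by case: (comp_st f'f) => _ <-; rewrite tgt_src.
  have f'f2 : comp f' f = Some (tgt f') by rewrite tf'.
  have g'g2 : comp g' g = Some (tgt g') by rewrite tg'.
  have [l [El kl]] := comp_mid Ek f'f2 g'g2.
  have [_ tk] := comp_st Ek; exists k; split=> //.
  by move: kl; rewrite tk tg' -sh; case: (etrans (esym Eh) El) => <-.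
Defined.

(* Functors and natural transformations in arrows-only form: components are   *)
(* indexed by identity morphisms.                                             *)
Record functor (A B : category) := Functor {
  fmor :> A -> B;
  fmor_src : forall f, fmor (src f) = src (fmor f);
  fmor_tgt : forall f, fmor (tgt f) = tgt (fmor f);
  fmor_comp : forall f g h,
    comp f g = Some h -> comp (fmor f) (fmor g) = Some (fmor h) }.

Definition id_functor (A : category) : functor A A :=
  @Functor A A id (fun=> erefl) (fun=> erefl) (fun _ _ _ E => E).

Record nat_trans (A B : category) (F G : functor A B) := NatTrans {
  component :> ids A -> B;
  component_src : forall X, src (component X) = F (sval X);
  component_tgt : forall X, tgt (component X) = G (sval X);
  naturality : forall f : A,
    comp (G f) (component (src_id f)) = comp (component (tgt_id f)) (F f) }.

Definition counit (A : category) (C : functor A A) := nat_trans C (id_functor A).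

(* D is the collection <|X; lbase is a |-> a<| and lanchor is x |-> <|x.      *)
Record left_action (A : category) (X D : Type) := LeftAction {
  lbase : A -> D;
  lanchor : X -> D;
  lact : A -> X -> option X;
  lact_def : forall a x, lact a x <-> lbase a = lanchor x;
  lbase_src : forall a, lbase (src a) = lbase a;
  lact_src : forall a x, lact (src a) x -> lact (src a) x = Some x;
  lact_comp : forall a b x y,
    obind (fun c => lact c x) (comp a b) = Some y ->
    obind (lact a) (lact b x) = Some y }.

(* D is the collection X|>; rbase is b |-> |>b and ranchor is x |-> x|>.      *)
Record right_action (X : Type) (B : category) (D : Type) := RightAction {
  rbase : B -> D;
  ranchor : X -> D;
  ract : X -> B -> option X;
  ract_def : forall x b, ract x b <-> ranchor x = rbase b;
  rbase_tgt : forall b, rbase (tgt b) = rbase b;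
  ract_tgt : forall x b, ract x (tgt b) -> ract x (tgt b) = Some x;
  ract_comp : forall x a b y,
    obind (ract x) (comp a b) = Some y ->
    obind (fun z => ract z b) (ract x a) = Some y }.

Definition left_full (A : category) (X D : Type) (L : left_action A X D) :=
  forall a, exists x, lbase L a = lanchor L x.

Definition right_full (X : Type) (B : category) (D : Type)
    (R : right_action X B D) :=
  forall b, exists x, ranchor R x = rbase R b.

Record left_capsule (A X : category) := LeftCapsule {
  lcaps :> left_action A X (ids X);
  lcaps_full : left_full lcaps;
  lcaps_tgt : forall x, lanchor lcaps x = tgt_id x;
  lcaps_comp : forall a x y,
    obind (lact lcaps a) (comp x y) = obind (fun z => comp z y) (lact lcaps a x) }.

Record right_capsule (X B : category) := RightCapsule {
  rcaps :> right_action X B (ids X);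
  rcaps_full : right_full rcaps;
  rcaps_src : forall x, ranchor rcaps x = src_id x;
  rcaps_comp : forall x y b,
    obind (fun z => ract rcaps z b) (comp x y) = obind (comp x) (ract rcaps y b) }.

Record bicapsule (A X B : category) := Bicapsule {
  bleft : left_capsule A X;
  bright : right_capsule X B;
  bicaps_assoc : forall a x b,
    obind (lact bleft a) (ract bright x b) =
    obind (fun y => ract bright y b) (lact bleft a x) }.

(* The domain of lact (resp. ract) determines the anchors a<| (resp. |>b), so *)
(* the regular structures are identified by their operation alone.            *)
Definition left_regular (A : category) (L : left_capsule A A) : Prop :=
  forall a x : A, lact L a x = comp a x.

Definition right_regular (B : category) (R : right_capsule B B) : Prop :=
  forall x b : B, ract R x b = comp x b.

(* [act_unit L a] is a . 1_X, i.e. a . e for the unique identity e of X for   *)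
(* which this is defined; [act_unitP] shows that this identity is a<|.        *)
Definition act_unit (A X : category) (L : left_capsule A X) (a : A) : option X :=
  lact L a (sval (lbase L a)).

Lemma act_unitP (A X : category) (L : left_capsule A X) (a : A) (e : ids X) :
  lact L a (sval e) <-> e = lbase L a.
Proof.
rewrite lact_def lcaps_tgt.
have -> : tgt_id (sval e) = e by apply: ids_inj; rewrite /= tgt_ids.
by split=> ->.
Qed.

(* Partial functions M with M(a.y.b) = a.M(y).b whenever a.y.b is defined.    *)
Definition bimorphism (A Y X B : category)
    (KY : bicapsule A Y B) (KX : bicapsule A X B) (M : Y -> option X) : Prop :=
  forall (a : A) (y : Y) (b : B) (z : Y),
    obind (fun u => ract (bright KY) u b) (lact (bleft KY) a y) = Some z ->
    exists w : X, M z = Some w /\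
      obind (fun m => obind (fun n => ract (bright KX) n b) (lact (bleft KX) a m))
            (M y) = Some w.

Record signature := Signature { op : Type; arity : op -> nat }.

Inductive term (S : signature) : Type :=
| Var of nat
| App (o : op S) of ('I_(arity o) -> term S).

Fixpoint eval (S : signature) (X : Type)
    (ops : forall o : op S, ('I_(arity o) -> X) -> X)
    (env : nat -> X) (t : term S) : X :=
  match t with
  | Var n => env n
  | App o ts => ops o (fun i => eval ops env (ts i))
  end.

Record variety := Variety {
  vsig : signature;
  law : term vsig -> term vsig -> Prop }.

(* Algebras may be empty when the signature has no constants.                 *)
Record algebra (V : variety) := Algebra {
  carrier :> Type;
  oper : forall o : op (vsig V), ('I_(arity o) -> carrier) -> carrier;
  oper_law : forall l r : term (vsig V), law l r ->
    forall env : nat -> carrier, eval oper env l = eval oper env r }.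

Arguments oper {V} a o.

Record hom (V : variety) (X Y : algebra V) := Hom {
  hfun :> X -> Y;
  hfun_oper : forall (o : op (vsig V)) (args : 'I_(arity o) -> X),
    hfun (oper X o args) = oper Y o (hfun \o args) }.

Lemma hom_inj (V : variety) (X Y : algebra V) (f g : hom X Y) :
  (forall x, f x = g x) -> f = g.
Proof.
case: f g => [f Hf] [g Hg] /= /funext E; case: g / E in Hg *.
by rewrite (Prop_irrelevance Hf Hg).
Qed.

Definition hom_id (V : variety) (X : algebra V) : hom X X :=
  @Hom V X X id (fun _ _ => erefl).

Lemma hom_comp_subproof (V : variety) (X Y Z : algebra V)
    (f : hom Y Z) (g : hom X Y) (o : op (vsig V)) (args : 'I_(arity o) -> X) :
  (f \o g) (oper X o args) = oper Z o ((f \o g) \o args).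
Proof. by rewrite /= !hfun_oper. Qed.

Definition hom_comp (V : variety) (X Y Z : algebra V)
    (f : hom Y Z) (g : hom X Y) : hom X Z :=
  Hom (hom_comp_subproof f g).

Record arrow (V : variety) := Arrow {
  adom : algebra V;
  acod : algebra V;
  ahom :> hom adom acod }.

Arguments Arrow {V adom acod} ahom.

Section AlgCat.
Variable V : variety.

Definition arrow_id (X : algebra V) : arrow V := Arrow (hom_id X).

(* Two arrows compose when the middle algebras are equal as objects (not      *)
(* merely isomorphic).                                                        *)
Definition arrow_comp (f g : arrow V) : option (arrow V) :=
  match pselect (adom f = acod g) with
  | left e => Some (Arrow (hom_comp (ahom f)
                (eq_rect _ (fun Y => hom (adom g) Y) (ahom g) _ (esym e))))
  | right _ => None
  end.

Lemma arrow_compE (X Y Z : algebra V) (f : hom Y Z) (g : hom X Y) :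
  arrow_comp (Arrow f) (Arrow g) = Some (Arrow (hom_comp f g)).
Proof.
rewrite /arrow_comp /=; case: pselect => // e.
by rewrite (Prop_irrelevance e erefl).
Qed.

Lemma arrow_compP (f g h : arrow V) : arrow_comp f g = Some h ->
  exists (X Y Z : algebra V) (u : hom Y Z) (v : hom X Y),
    [/\ f = Arrow u, g = Arrow v & h = Arrow (hom_comp u v)].
Proof.
case: f g => [Y Z u] [X Y' v] E.
have e : Y = Y' by move: E; rewrite /arrow_comp /=; case: pselect.
case: Y' / e in v E *; move: E; rewrite arrow_compE => -[<-].
by exists X, Y, Z, u, v.
Qed.

Lemma arrow_comp_def (f g : arrow V) :
  arrow_comp f g <-> arrow_id (adom f) = arrow_id (acod g).
Proof.
rewrite /arrow_comp; case: pselect => [e|ne].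
  by split=> // _; congr arrow_id.
by split=> // /(congr1 (@adom V)).
Qed.

Definition alg_cat : category.
Proof.
refine (@Category (arrow V) (fun f => arrow_id (adom f))
  (fun f => arrow_id (acod f)) arrow_comp _ _ _ _ _ _ _ _ _) => //.
- exact: arrow_comp_def.
- by move=> f g h /arrow_compP [X [Y [Z [u [v [-> -> ->]]]]]].
- by case=> X Y f; rewrite arrow_compE; congr (Some (Arrow _)); apply: hom_inj.
- by case=> X Y f; rewrite arrow_compE; congr (Some (Arrow _)); apply: hom_inj.
- move=> f g h.
  case Egh: (arrow_comp g h) => [k|] /=.
    have [X [Y [Z [u [v [-> -> ->]]]]]] := arrow_compP Egh.
    case: f => Z' T f.
    case: (pselect (Z' = Z)) => [e|ne].
      case: Z / e in u *; rewrite !arrow_compE /= arrow_compE.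
      by congr (Some (Arrow _)); apply: hom_inj.
    by rewrite /arrow_comp /=; case: pselect.
  case Efg: (arrow_comp f g) => [k|] //=.
  have [X [Y [Z [u [v [_ Eg ->]]]]]] := arrow_compP Efg.
  by move: Egh; rewrite Eg /arrow_comp /=; case: pselect.
Defined.

End AlgCat.

Record subalgebra (V : variety) (G : algebra V) := Subalgebra {
  sub_set : set G;
  sub_closed : forall (o : op (vsig V)) (args : 'I_(arity o) -> G),
    (forall i, sub_set (args i)) -> sub_set (oper G o args) }.

Section Subalgebra.
Variables (V : variety) (G : algebra V) (H : subalgebra G).

Let sub_carrier : Type := {x : G | sub_set H x}.

Definition sub_oper (o : op (vsig V)) (args : 'I_(arity o) -> sub_carrier) :
    sub_carrier :=
  exist _ (oper G o (fun i => sval (args i)))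
    (sub_closed (fun i => svalP (args i))).

Lemma eval_sub (env : nat -> sub_carrier) (t : term (vsig V)) :
  sval (eval sub_oper env t) = eval (oper G) (fun n => sval (env n)) t.
Proof.
by elim: t => //= o ts IH; congr (oper G o _); apply: funext => i; apply: IH.
Qed.

Lemma sub_oper_law (l r : term (vsig V)) : law l r ->
  forall env : nat -> sub_carrier, eval sub_oper env l = eval sub_oper env r.
Proof.
move=> lr env.
have := oper_law lr (fun n => sval (env n)); rewrite -!eval_sub.
by case: (eval _ _ l) (eval _ _ r) => [x Hx] [y Hy] /= E; apply: eq_exist.
Qed.

Definition sub_alg : algebra V := Algebra sub_oper_law.

Definition sub_incl : hom sub_alg G :=
  @Hom V sub_alg G (fun x => sval x) (fun _ _ => erefl).

End Subalgebra.

Definition characteristic (V : variety) (G : algebra V) (H : subalgebra G) : Prop :=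
  forall phi : hom G G, @iso (alg_cat V) (Arrow phi) ->
    phi @` sub_set H = sub_set H.

(* The image of an arrow f, as a subset of an algebra G: used when the        *)
(* codomain of f is provably, but not syntactically, equal to G.              *)
Definition arrow_image (V : variety) (f : arrow V) (G : algebra V) : set G :=
  [set y | exists (K : algebra V) (h : hom K G), f = Arrow h /\ range h y].

Arguments arrow_image {V} f G.

Definition id_in (V : variety) (A : subcategory (alg_cat V))
    (hA : sub_le (core (alg_cat V)) A) (G : algebra V) : A :=
  exist _ (arrow_id G) (hA _ (@iso_src (alg_cat V) (arrow_id G))).

Lemma id_in_src (V : variety) (A : subcategory (alg_cat V))
    (hA : sub_le (core (alg_cat V)) A) (G : algebra V) :
  src (id_in hA G) = id_in hA G.
Proof. exact: subm_inj. Qed.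

Definition obj_in (V : variety) (A : subcategory (alg_cat V))
    (hA : sub_le (core (alg_cat V)) A) (G : algebra V) : ids A :=
  exist _ (id_in hA G) (id_in_src hA G).

(* Main.v *)
From mathcomp Require Import all_boot.
From mathcomp Require Import boolp classical_sets.
Require Import Defs.

Set Implicit Arguments.
Unset Strict Implicit.
Unset Printing Implicit Defensive.

Local Open Scope classical_set_scope.

(** Let [K(X)] be the set of all [x] in [X] that every isomorphism [X -> G]
    sends into [H]. It is a subalgebra of [X], isomorphisms [X -> Y] map [K(X)]
    onto [K(Y)], and [K(G) = H] exactly when [H] is characteristic. Let [A] be
    generated by the isomorphisms and the inclusions [K(X) -> X]. The arrows of
    [A] restrict to the [K(X)], so [K] is a functor and the inclusions form a
    counit, whose component at [G] is the inclusion of [H] if [H] is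
    characteristic.

    A counit [eta : C => id] gives a bimorphism with [B = A]: let [A] act on
    itself regularly, except that its right action on the codomain is
    [x . b = x C(b)], and put [M(y) = y eta_(src y) = eta_(tgt y) C(y)].
    Conversely, each of (2) and (3) gives, for every automorphism [phi] of [G],
    an arrow [c] with [phi e = e c], where [e] is an arrow with image [H]; hence
    [phi(H)] lies in [H]. *)

(** * Capsules and bimorphisms over arbitrary categories *)

Section Capsules.

Definition regular_left_action (A : category) : left_action A A (ids A).
Proof.
refine (@LeftAction A A (ids A) (@src_id A) (@tgt_id A) (@comp A) _ _ _ _).
- move=> a x; rewrite comp_def; split=> [E|/(congr1 sval) //].
  exact: ids_inj.
- by move=> a; apply: ids_inj; rewrite /= src_src.
- move=> a x /comp_def; rewrite src_src => ->; exact: comp_tgt.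
- move=> a b x y; rewrite comp_assoc; exact.
Defined.

Definition regular_left_capsule (A : category) : left_capsule A A.
Proof.
refine (@LeftCapsule A A (regular_left_action A) _ _ _) => //=.
- by move=> a; exists (src a); apply: ids_inj; rewrite /= tgt_src.
- by move=> a x y; rewrite comp_assoc.
Defined.

(** For the identity functor this is the right regular action, so one construction supplies both
    bicapsules built from a counit. *)
Definition functor_right_action (X B : category) (F : functor B X) :
  right_action X B (ids X).
Proof.
refine (@RightAction X B (ids X) (fun b => tgt_id (F b)) (@src_id X)
         (fun x b => comp x (F b)) _ _ _ _).
- move=> x b; rewrite comp_def; split=> [E|/(congr1 sval) //].
  exact: ids_inj.
- by move=> b; apply: ids_inj; rewrite /= fmor_tgt tgt_tgt.
- move=> x b /comp_def; rewrite fmor_tgt tgt_tgt => <-; exact: comp_src.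
- move=> x a b y; case E: (comp a b) => [c|] //= <-.
  by rewrite -comp_assoc (fmor_comp F E).
Defined.

Definition functor_right_capsule (X B : category) (F : functor B X) :
  right_capsule X B.
Proof.
refine (@RightCapsule X B (functor_right_action F) _ _ _) => //=.
- by move=> b; exists (tgt (F b)); apply: ids_inj; rewrite /= src_tgt.
- by move=> x y b; rewrite comp_assoc.
Defined.

Definition functor_bicapsule (A B : category) (F : functor B A) :
  bicapsule A A B.
Proof.
refine (@Bicapsule A A B (regular_left_capsule A) (functor_right_capsule F) _).
by move=> a x b; rewrite /= comp_assoc.
Defined.

(** Compatibility with the left action is associativity; with the right action it is naturality at
    [b], as [y b eta_(src b) = y eta_(tgt b) C(b)]. *)
Lemma counit_bimorphism (A : category) (C : functor A A) (eta : counit C) :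
  exists (KB : bicapsule A A A) (KA : bicapsule A A A) (M : A -> option A),
    [/\ right_regular (bright KB), left_regular (bleft KA), bimorphism KB KA M &
        forall X : ids A,
          obind M (act_unit (bleft KB) (sval X)) = Some (eta X)].
Proof.
exists (functor_bicapsule (id_functor A)), (functor_bicapsule C),
  (fun y => comp y (eta (src_id y))); split=> //.
- move=> a y b z /=; case Eay: (comp a y) => [u|] //= Eub.
  have [su _] := comp_st Eay; have [sz _] := comp_st Eub.
  have sub : src u = tgt b by apply/comp_def; rewrite Eub.
  have -> : src_id z = src_id b by apply: ids_inj.
  have -> : src_id y = tgt_id b by apply: ids_inj; rewrite /= -su.
  have : comp z (eta (src_id b)) by apply/comp_def; rewrite component_tgt.
  case Ew: (comp z (eta (src_id b))) => [w|] // _; exists w; split=> //.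
  have nat_b : comp b (eta (src_id b)) = comp (eta (tgt_id b)) (C b).
    exact: (naturality eta b).
  rewrite -Ew -[RHS]/(obind (fun k => comp k (eta (src_id b))) (Some z)) -Eub.
  rewrite -comp_assoc nat_b comp_assoc.
  have -> : comp u (eta (tgt_id b)) = obind (comp a) (comp y (eta (tgt_id b))).
    by rewrite comp_assoc Eay.
  by case: (comp y _).
- move=> [e He]; rewrite /act_unit /= He.
  have -> : comp e e = Some e by rewrite -{2}He comp_src.
  rewrite /=.
  have -> : src_id e = exist _ e He by apply: ids_inj.
  have := comp_tgt (eta (exist _ e He)); rewrite component_tgt; exact.
Qed.

(** Put [p = a . e], where [e] is the identity with [X . e] defined. Writing [p] both as [a . e . e]
    and as [X . e . p] computes [M p] in two ways: as [a m] and as [m . p]. The capsule law turns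
    [m . p] into [m c] with [c = src m . p]. *)
Lemma bimorphism_factor (A B : category) (KB : bicapsule A B B)
    (KA : bicapsule A A B) (M : B -> option A) (a X m : A) :
  right_regular (bright KB) -> left_regular (bleft KA) -> bimorphism KB KA M ->
  src X = X -> src a = X -> tgt a = X ->
  obind M (act_unit (bleft KB) X) = Some m ->
  exists c, comp a m = comp m c.
Proof.
move=> RB LA bM sX sa ta; rewrite /act_unit.
set e := lbase (bleft KB) X.
have lte x : lact (bleft KB) x (sval e) <-> e = lbase (bleft KB) x by exact: act_unitP.
have Xe : lact (bleft KB) X (sval e) = Some (sval e).
  by rewrite -{1}sX; apply: lact_src; rewrite sX; apply/lte.
rewrite Xe /= => Me.
have ee : comp (sval e) (sval e) = Some (sval e).
  by have := comp_tgt (sval e); rewrite tgt_ids.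
have : lact (bleft KB) a (sval e).
  by apply/lte; rewrite /e -sa lbase_src.
case Ep: (lact _ a (sval e)) => [p|] // _.
have pe : comp p (sval e) = Some p.
  by have := lcaps_comp (bleft KB) a (sval e) (sval e); rewrite ee /= Ep.
(* Since [X a = a], the action of [X] on [p] is defined, which forces [tgt p = e]. *)
have ep : comp (sval e) p = Some p.
  have Xa : comp X a = Some a by rewrite -ta comp_tgt.
  have Xp : lact (bleft KB) X p.
    have := @lact_comp _ _ _ (bleft KB) X a (sval e) p.
    by rewrite Xa /= Ep => /(_ erefl) /= ->.
  have tp : tgt p = sval e.
    by move/lact_def: Xp; rewrite lcaps_tgt => /(congr1 sval).
  by rewrite -tp comp_tgt.
have := bM a (sval e) (sval e) p; rewrite Ep /= RB => /(_ pe) [w [Mp]].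
rewrite Me /= LA; case Eam: (comp a m) => [n|] //= Enw.
have := bM X (sval e) p p; rewrite Xe /= RB => /(_ ep) [w' [Mp']].
have <- : w = w' by move: Mp'; rewrite Mp => -[].
rewrite Me /= LA; case EXm: (comp X m) => [m'|] //=.
have Xm : X = tgt m by rewrite -sX; apply/comp_def; rewrite EXm.
have -> : m' = m by move: EXm; rewrite Xm comp_tgt => -[].
(* [e] is an identity of [B], so it acts trivially from the right. *)
have -> : w = n.
  have e_tgt : tgt (sval e) = sval e := tgt_ids e.
  move: Enw; rewrite -e_tgt => Enw.
  by move: (Enw); rewrite ract_tgt ?Enw // => -[].
have := rcaps_comp (bright KA) m (src m) p.
rewrite comp_src /= => ->; case: (ract _ (src m) p) => [c|] //= Ec.
by exists c.
Qed.

End Capsules.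

(** * Homomorphisms as arrows, and images of arrows *)

Section Homs.
Variable V : variety.

Lemma Arrow_inj (X Y : algebra V) (u v : hom X Y) : Arrow u = Arrow v -> u = v.
Proof.
pose ends (f : arrow V) := (adom f, acod f).
(* With an arbitrary arrow [f] on the right, the equation can be eliminated; at [f = Arrow u] the
   transport is along a loop, trivial by proof irrelevance. *)
have K (f : arrow V) (E : Arrow v = f) :
    eq_rect (X, Y) (fun p => hom p.1 p.2) v _ (congr1 ends E) = ahom f.
  by case: f / E.
by move=> /esym E; have := K _ E; rewrite (Prop_irrelevance (congr1 ends E) erefl).
Qed.

Definition is_iso (X Y : algebra V) (f : hom X Y) : Prop :=
  exists g : hom Y X, cancel f g /\ cancel g f.

Lemma iso_Arrow (X Y : algebra V) (f : hom X Y) :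
  @iso (alg_cat V) (Arrow f) <-> is_iso f.
Proof.
split=> [[[Y' X' g]] /= [Efg Egf]|[g [fK gK]]]; last first.
  exists (Arrow g); split; rewrite /= arrow_compE.
    by congr (Some (Arrow _)); apply: hom_inj.
  by congr (Some (Arrow _)); apply: hom_inj.
have EX : X = X'.
  by move: Efg; rewrite /arrow_comp /=; case: pselect.
have EY : Y' = Y.
  by move: Egf; rewrite /arrow_comp /=; case: pselect.
case: X' / EX in g Efg Egf *; case: Y / EY in f Efg Egf *.
move: Efg Egf; rewrite !arrow_compE => /Some_inj/Arrow_inj Efg /Some_inj/Arrow_inj Egf.
exists g; split=> x.
  exact: (congr1 (fun h : hom _ _ => h x) Egf).
exact: (congr1 (fun h : hom _ _ => h x) Efg).
Qed.

Lemma is_iso_id (X : algebra V) : is_iso (hom_id X).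
Proof. by exists (hom_id X). Qed.

Lemma is_iso_comp (X Y Z : algebra V) (f : hom Y Z) (g : hom X Y) :
  is_iso f -> is_iso g -> is_iso (hom_comp f g).
Proof.
move=> [f' [fK f'K]] [g' [gK g'K]]; exists (hom_comp g' f').
by split=> x /=; rewrite ?fK ?gK ?g'K ?f'K.
Qed.

Lemma arrow_image_Arrow (X Y : algebra V) (h : hom X Y) :
  arrow_image (Arrow h) Y = range h.
Proof.
apply/seteqP; split=> y; last by move=> hy; exists X, h.
move=> [K [k [E ky]]].
have EX : K = X by rewrite -[K]/(adom (Arrow k)) -E.
by case: X / EX in h E *; rewrite (Arrow_inj E).
Qed.

(** The reverse inclusion follows by applying the hypothesis to the inverse automorphism. *)
Lemma characteristic_subset (G : algebra V) (H : subalgebra G) :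
  (forall phi : hom G G, is_iso phi -> phi @` sub_set H `<=` sub_set H) ->
  characteristic H.
Proof.
move=> sub phi /iso_Arrow isophi; apply/seteqP; split; first exact: sub.
have [psi [phiK psiK]] := isophi => x Hx; exists (psi x) => //.
by apply: (sub psi); [exists phi | exists x].
Qed.

(** Pointwise, [phi (e x) = e (c x)]. Here [e] is a bare arrow because the codomain of a counit
    component is only provably equal to [G]. *)
Lemma characteristic_factor (G : algebra V) (H : subalgebra G) (e : arrow V) :
  sub_set H = arrow_image e G -> acod e = G ->
  (forall phi : hom G G, is_iso phi -> exists c, arrow_comp (Arrow phi) e = arrow_comp e c) ->
  characteristic H.
Proof.
case: e => K G' e HE /= EG; case: G / EG in H HE *.
move=> fact; apply: characteristic_subset => phi /fact [[W K' c]].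
rewrite HE arrow_image_Arrow arrow_compE => E.
(* The composite on the left is defined, hence so is the one on the right. *)
have EK : K = K'.
  by move: E; rewrite /arrow_comp /=; case: pselect.
case: K' / EK in c E *; move: E; rewrite arrow_compE => /Some_inj E.
have EW : K = W := congr1 (@adom V) E.
case: W / EW in c E *; move: E => /Arrow_inj E _ [_ [x _ <-] <-].
exists (c x) => //; exact: (congr1 (fun h : hom _ _ => h x) (esym E)).
Qed.

End Homs.

(** * The category generated by isomorphisms and core inclusions, with its counit *)

Section CharacteristicCore.
Variables (V : variety) (G : algebra V) (H : subalgebra G).

Definition char_core (X : algebra V) : subalgebra X.
Proof.
refine (@Subalgebra V X
  [set x | forall phi : hom X G, is_iso phi -> sub_set H (phi x)] _).
move=> o args Kargs phi isophi; rewrite hfun_oper; apply: sub_closed => i.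
exact: Kargs.
Defined.

(** Equality of subalgebras, rather than of their sets, makes the counit component at [G] literally
    the arrow [Arrow (sub_incl H)]. *)
Lemma char_core_characteristic : characteristic H -> char_core G = H.
Proof.
move=> charH.
have E : sub_set (char_core G) = sub_set H.
  apply/seteqP; split=> x; first by move=> /(_ _ (is_iso_id G)).
  move=> Hx phi /iso_Arrow /charH <-; by exists x.
case: (char_core G) (H) E => [S1 c1] [S2 c2] /= E.
by case: S2 / E in c2 *; rewrite (Prop_irrelevance c1 c2).
Qed.

Notation K X := (sub_alg (char_core X)).
Notation incl X := (sub_incl (char_core X)).

Definition preserves_core (X Y : algebra V) (f : hom X Y) : Prop :=
  forall x, sub_set (char_core X) x -> sub_set (char_core Y) (f x).

Definition restrict (X Y : algebra V) (f : hom X Y) (p : preserves_core f) :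
  hom (K X) (K Y).
Proof.
refine (@Hom V (K X) (K Y)
  (fun x => exist _ (f (sval x)) (p (sval x) (svalP x))) _).
move=> o args; apply: eq_exist; exact: hfun_oper.
Defined.

Lemma iso_preserves_core (X Y : algebra V) (f : hom X Y) :
  is_iso f -> preserves_core f.
Proof. by move=> isof x Kx phi isophi; apply: (Kx _ (is_iso_comp isophi isof)). Qed.

Lemma restrict_iso (X Y : algebra V) (f : hom X Y) (p : preserves_core f) :
  is_iso f -> is_iso (restrict p).
Proof.
move=> [g [fK gK]].
have q : preserves_core g by apply: iso_preserves_core; exists f.
by exists (restrict q); split=> -[x Kx]; apply: eq_exist; rewrite /= ?fK ?gK.
Qed.

Lemma sub_alg_inj (X : algebra V) (S : subalgebra X) (x y : sub_alg S) :
  sval x = sval y -> x = y.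
Proof. by case: x y => [x Sx] [y Sy] /= E; apply: eq_exist. Qed.

(** Normal form for the arrows of the generated category: one isomorphism followed by a chain of
    inclusions. Closure under composition is then a lemma. *)
Inductive admissible : forall X Y : algebra V, hom X Y -> Prop :=
| admissible_iso X Y (f : hom X Y) : is_iso f -> admissible f
| admissible_incl X Y (f : hom X (K Y)) :
    admissible f -> admissible (hom_comp (incl Y) f).

Lemma admissible_inclusion (X : algebra V) : admissible (incl X).
Proof.
have -> : incl X = hom_comp (incl X) (hom_id _) by exact: hom_inj.
by apply: admissible_incl; apply: admissible_iso; apply: is_iso_id.
Qed.

(** An isomorphism moves past an inclusion by restricting to the cores, where it is again an
    isomorphism. *)
Lemma admissible_iso_comp (X Y : algebra V) (g : hom X Y) : admissible g ->
  forall (Z : algebra V) (f : hom Y Z), is_iso f -> admissible (hom_comp f g).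
Proof.
elim=> {X Y g} [X Y g isog|X Y g _ IH] Z f isof.
  exact/admissible_iso/is_iso_comp.
have p := iso_preserves_core isof.
have -> : hom_comp f (hom_comp (incl Y) g) =
          hom_comp (incl Z) (hom_comp (restrict p) g) by exact: hom_inj.
by apply/admissible_incl/IH/restrict_iso.
Qed.

Lemma admissible_comp (Y Z : algebra V) (f : hom Y Z) : admissible f ->
  forall (X : algebra V) (g : hom X Y), admissible g -> admissible (hom_comp f g).
Proof.
elim=> {Y Z f} [Y Z f isof|Y Z f _ IH] X g adm_g.
  exact: admissible_iso_comp.
have -> : hom_comp (hom_comp (incl Z) f) g = hom_comp (incl Z) (hom_comp f g).
  exact: hom_inj.
exact/admissible_incl/IH.
Qed.

(** An arrow that ends with an inclusion sends its whole domain into the core of its codomain. *)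
Lemma admissible_preserves_core (X Y : algebra V) (f : hom X Y) :
  admissible f -> preserves_core f.
Proof.
case=> {X Y f} [X Y f|X Y f _ x _]; first exact: iso_preserves_core.
exact: (svalP (f x)).
Qed.

(** If an arrow is an inclusion after [f], its restriction is [f] after the inclusion of the core of
    its domain. *)
Lemma restrict_admissible (X Y : algebra V) (f : hom X Y) (p : preserves_core f) :
  admissible f -> admissible (restrict p).
Proof.
move=> adm_f; case: adm_f p => {X Y f} [X Y f isof|X Y f adm_f] p.
  exact/admissible_iso/restrict_iso.
have -> : restrict p = hom_comp f (incl X).
  by apply: hom_inj => x; apply: sub_alg_inj.
exact/admissible_comp/admissible_inclusion.
Qed.

Definition core_cat : subcategory (alg_cat V).
Proof.
refine (@Subcategory (alg_cat V) (fun f : arrow V => admissible (ahom f)) _ _ _).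
- by move=> f _; apply/admissible_iso/is_iso_id.
- by move=> f _; apply/admissible_iso/is_iso_id.
- move=> f g h Pf Pg /arrow_compP [X [Y [Z [u [v [Ef Eg Eh]]]]]].
  move: Pf Pg; rewrite Ef Eg Eh /= => /admissible_comp; exact.
Defined.

Lemma core_cat_isos : sub_le (core (alg_cat V)) core_cat.
Proof. by case=> X Y f /iso_Arrow; apply: admissible_iso. Qed.

Definition core_mor (f : core_cat) : core_cat :=
  let p := admissible_preserves_core (svalP f) in
  exist _ (Arrow (restrict p)) (restrict_admissible p (svalP f)).

Definition core_functor : functor core_cat core_cat.
Proof.
refine (@Functor core_cat core_cat core_mor _ _ _).
- move=> f; apply: subm_inj; congr Arrow; apply: hom_inj => x.
  by apply: sub_alg_inj.
- move=> f; apply: subm_inj; congr Arrow; apply: hom_inj => x.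
  by apply: sub_alg_inj.
- move=> [[Y Z u] Pu] [[X Y' v] Pv] [h Ph] /(congr1 (omap sval)) E.
  apply: omap_sval_inj; move: E; rewrite !subc_compE /= => E.
  have EY : Y = Y' by move: E; rewrite /arrow_comp /=; case: pselect.
  case: Y' / EY in v Pv E *; move: E; rewrite !arrow_compE => /Some_inj Eh.
  case: h / Eh in Ph *; congr (Some (Arrow _)); apply: hom_inj => x.
  exact: sub_alg_inj.
Defined.

Definition core_counit : counit core_functor.
Proof.
pose incl_in (X : algebra V) : core_cat :=
  exist _ (Arrow (incl X)) (admissible_inclusion X).
refine (@NatTrans _ _ core_functor (id_functor _)
  (fun X => incl_in (acod (sval (sval X)))) _ _ _).
(* An element of [ids] is an arrow merely equal to its source, so its two end algebras are
   identified first, and then [f] with the identity. *)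
- move=> [[[X Y f] Pf] /(congr1 sval) /= Ef].
  apply: (@subm_inj (alg_cat V) core_cat) => /=.
  have EY : X = Y := congr1 (@acod V) Ef.
  case: Y / EY in f Pf Ef *; have Ef' := Arrow_inj Ef.
  by case: f / Ef' in Pf {Ef} *; congr Arrow; apply: hom_inj => x; apply: sub_alg_inj.
- move=> [[[X Y f] Pf] /(congr1 sval) /= Ef].
  apply: (@subm_inj (alg_cat V) core_cat) => /=.
  have EY : X = Y := congr1 (@acod V) Ef.
  by case: Y / EY in f Pf Ef *.
- move=> [[X Y f] Pf]; apply: omap_sval_inj; rewrite !subc_compE /= !arrow_compE.
  by congr (Some (Arrow _)); apply: hom_inj.
Defined.

End CharacteristicCore.

Theorem mainTheorem4 (V : variety) (G : algebra V) (H : subalgebra G) :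
  exists (A : subcategory (alg_cat V)) (B : category)
         (hA : sub_le (core (alg_cat V)) A),
    (characteristic H <->
       exists (C : functor A A) (eta : counit C),
         sub_set H = arrow_image (sval (eta (obj_in hA G))) G) /\
    (characteristic H <->
       exists (KB : bicapsule A B B) (KA : bicapsule A A B)
              (M : B -> option A),
         [/\ right_regular (bright KB),
             left_regular (bleft KA),
             bimorphism KB KA M &
             omap sval (obind M (act_unit (bleft KB) (id_in hA G)))
               = Some (Arrow (sub_incl H))]).
Proof.
have range_incl : range (sub_incl H) = sub_set H.
  apply/seteqP; split=> [_ [[x Hx] _ <-] //|x Hx].
  by exists (exist _ x Hx).
pose A := core_cat H; pose hA := @core_cat_isos V G H.
pose aut (phi : hom G G) (isophi : is_iso phi) : A :=
  exist _ (Arrow phi) (admissible_iso H isophi).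
(* The choice [B = A] serves for (3). *)
exists A, A, hA; split; split.
- move=> charH; exists (core_functor H), (core_counit H) => /=.
  by rewrite char_core_characteristic // arrow_image_Arrow range_incl.
- move=> [C [eta HE]]; apply: (characteristic_factor HE).
    have /(congr1 sval)/(congr1 (@acod V)) := component_tgt eta (obj_in hA G).
    exact.
  (* Naturality at [phi] reads [phi eta_G = eta_G C(phi)], because both ends of [phi] are [G]. *)
  move=> phi isophi; exists (sval (C (aut phi isophi))).
  have /(congr1 (omap sval)) := naturality eta (aut phi isophi).
  rewrite !subc_compE /=.
  have -> : src_id (aut phi isophi) = obj_in hA G by apply/ids_inj/subm_inj.
  have -> // : tgt_id (aut phi isophi) = obj_in hA G by apply/ids_inj/subm_inj.
- move=> charH; have [KB [KA [M [RB LA bM ME]]]] := counit_bimorphism (core_counit H).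
  exists KB, KA, M; split=> //.
  by rewrite (ME (obj_in hA G)) /= char_core_characteristic.
- move=> [KB [KA [M [RB LA bM]]]].
  case ME: (obind _ _) => [m|] //= /Some_inj mE.
  apply: (@characteristic_factor _ _ _ (Arrow (sub_incl H))) => //.
    by rewrite arrow_image_Arrow range_incl.
  move=> phi isophi.
  (* Taken at the identity of [G], where [m] is the inclusion of [H]. *)
  have [||| c /(congr1 (omap sval))] := bimorphism_factor (a := aut phi isophi) RB LA bM _ _ _ ME.
  + exact: subm_inj.
  + exact: subm_inj.
  + exact: subm_inj.
  by rewrite !subc_compE mE => E; exists (sval c).
Qed.
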